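(* Let $n \geq 2$ and $t \geq 3$ be integers. Then the direct product $K_n \times C_t$ is $1$-resilient, and thus \[ Z_{(1)}(K_n \times C_t) = Z_{(0)}(K_n \times C_t) = \begin{cases} (n-2)t + 2 & \text{if } t \text{ is odd}, \\ (n-2)t + 4 & \text{if } t \text{ is even}. \end{cases} \]
   Context: $K_n$ is the complete graph on $n$ vertices and $C_t$ is the cycle on $t$ vertices. The direct product $G \times H$ of graphs $G$ and $H$ has vertex set $V(G) \times V(H)$, and $(g,h)$ and $(g',h')$ are adjacent if and only if $gg' \in E(G)$ and $hh' \in E(H)$. Zero forcing: a set $B \subseteq V(G)$ is initially colored blue and all other vertices are uncolored. Color change rule: a blue vertex $v$ can force (color blue) an uncolored neighbor $u$ if $u$ is the only uncolored neighbor of $v$. The rule is applied repeatedly. $B$ is a zero forcing set if all vertices of $G$ can eventually be forced (become blue). Leaky forcing: for an integer $\ell \geq 0$, a leak is a vertex that is not allowed to force any neighbor, even if it satisfies the color change rule (a leak may itself be colored or be forced by others). A set $B \subseteq V(G)$ is an $\ell$-leaky forcing set if, for every choice of $\ell$ vertices of $G$ as leaks (chosen after $B$ is fixed), starting from $B$ blue, all vertices of $G$ can eventually be forced using only forces by non-leak vertices. $Z_{(\ell)}(G)$ is the minimum cardinality of an $\ell$-leaky forcing set of $G$; $Z_{(0)}(G)$ is the usual zero forcing number. $G$ is $\ell$-resilient if $Z_{(\ell)}(G) = Z_{(0)}(G)$. *)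

(* Defs.v *)
From HB Require Import structures.
From mathcomp Require Import all_boot.

Set Implicit Arguments.
Unset Strict Implicit.
Unset Printing Implicit Defensive.

Record sgraph := SGraph {
  vertex :> finType;
  adj : rel vertex;
  adj_sym : symmetric adj;
  adj_irrefl : irreflexive adj }.

Definition complete_rel n : rel 'I_n := fun i j => i != j.

Lemma complete_sym n : symmetric (@complete_rel n).
Proof. by move=> i j; rewrite /complete_rel eq_sym. Qed.

Lemma complete_irrefl n : irreflexive (@complete_rel n).
Proof. by move=> i; rewrite /complete_rel eqxx. Qed.

Definition complete_graph n : sgraph :=
  SGraph (@complete_sym n) (@complete_irrefl n).

(* [ordS i] is i + 1 modulo t. The conjunct [i != j] only matters for t = 1,
   where it removes the loop; for 3 <= t this is the usual cycle. *)
Definition cycle_rel t : rel 'I_t :=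
  fun i j => (i != j) && ((j == ordS i) || (i == ordS j)).

Lemma cycle_sym t : symmetric (@cycle_rel t).
Proof. by move=> i j; rewrite /cycle_rel eq_sym orbC. Qed.

Lemma cycle_irrefl t : irreflexive (@cycle_rel t).
Proof. by move=> i; rewrite /cycle_rel eqxx. Qed.

Definition cycle_graph t : sgraph :=
  SGraph (@cycle_sym t) (@cycle_irrefl t).

Section DirectProduct.
Variables G H : sgraph.

Definition direct_prod_rel : rel (G * H)%type :=
  fun x y => adj x.1 y.1 && adj x.2 y.2.

Lemma direct_prod_sym : symmetric direct_prod_rel.
Proof.
by move=> x y; rewrite /direct_prod_rel (adj_sym x.1) (adj_sym x.2).
Qed.

Lemma direct_prod_irrefl : irreflexive direct_prod_rel.
Proof. by move=> x; rewrite /direct_prod_rel adj_irrefl. Qed.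

Definition direct_prod : sgraph := SGraph direct_prod_sym direct_prod_irrefl.

End DirectProduct.

Section LeakyForcing.
Variable G : sgraph.
Implicit Types (L B : {set G}) (l : nat).

Definition can_force L B (v u : G) : bool :=
  [&& v \in B, v \notin L, adj v u, u \notin B
    & [forall w, adj v w && (w \notin B) ==> (w == u)]].

Definition force_step L : rel {set G} :=
  fun B B' => [exists v, exists u, can_force L B v u && (B' == u |: B)].

Definition forces_all L B : bool := connect (force_step L) B [set: G].

Definition leaky_forcing_set l B : bool :=
  [forall L : {set G}, (#|L| == l) ==> forces_all L B].

(* The default value [set: G] of the arg min below is itself admissible, so
   the minimum is genuinely attained. *)
Lemma leaky_forcing_setT l : leaky_forcing_set l [set: G].
Proof. by apply/forallP=> L; apply/implyP=> _; apply: connect0. Qed.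

Definition leaky_forcing_number l : nat :=
  #|[arg min_(B < [set: G] | leaky_forcing_set l B) #|B|]|.

Definition resilient l : Prop :=
  leaky_forcing_number l = leaky_forcing_number 0.

End LeakyForcing.

(* Main.v *)
Require Import Defs.
From mathcomp Require Import all_boot all_order all_algebra zify ring.

(** Let [d] be the number of connected components of [K_2 x C_t]: it is [1]
    when [t] is odd (a single cycle of length [2t]) and [2] when [t] is even
    (two cycles of length [t]). Both forcing numbers equal [(n - 2) t + 2 d].
    Since tolerating a leak can only cost more, it suffices to bound the
    [0]-leaky number from below and the [1]-leaky number from above.

    Lower bound. Let [w] be a matrix indexed by the vertices whose nonzero
    entries are exactly the edges. If a vector of the kernel of [w] vanishes on
    a zero forcing set, then it vanishes everywhere, because each force isolates
    one unknown in one row of [w x = 0]. So a zero forcing set has at least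
    [dim ker w] elements ([zero_forcing_ge_nullity]). We take the tensor product
    of [(a - b)_(a, b)], which is a rank [2] matrix with the pattern of [K_n],
    and of the skew-symmetric signed adjacency matrix of [C_t] (shift minus
    inverse shift), whose kernel consists of the vectors with
    [x_(i + 1) = x_(i - 1)] and so has dimension [d]. The product has rank
    [2 (t - d)], hence nullity [n t - 2 (t - d)]. Concretely, [f] is in the
    kernel as soon as its two moments on column [i], the sums over [a] of
    [f (a, i)] and of [a f (a, i)], depend only on [i] modulo [d]
    ([constraint_kernel]).

    Upper bound. Colour blue all rows [a >= 2] and two consecutive vertices of
    each of the [d] cycles formed by rows [0] and [1]. A vertex in rows [0] and
    [1] has only two neighbours outside the rows [a >= 2], namely its neighbours
    on its cycle, so the forcing process runs along each cycle in both
    directions. One leak can stop it only at one vertex, whereas an uncoloured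
    gap needs a blocked vertex at each of its two ends
    ([closed_walk_blue]). *)

Set Implicit Arguments.
Unset Strict Implicit.
Unset Printing Implicit Defensive.
Import GRing.Theory Num.Theory.

(** * Stalled colourings and leaky forcing numbers *)

Section Forcing.
Variable G : sgraph.
Implicit Types (L B C : {set G}).

Definition stalled L C := [forall v, forall u, ~~ can_force L C v u].

(** Replaces reasoning on forcing sequences by reasoning on their end: for [B]
    to force the graph, it is enough that the only stalled set containing [B]
    is the full set. *)
Lemma connect_stalled L B :
  exists C, [/\ connect (force_step L) B C, B \subset C & stalled L C].
Proof.
have [m] := ubnP #|~: B|; elim: m B => // m IH B lt_m.
case: (boolP (stalled L B)) => [st|]; first by exists B; rewrite connect0.
case/forallPn=> v /forallPn[u]; rewrite negbK => vu.
have uB : u \notin B by case/and5P: vu.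
have ltU : #|~: (u |: B)| < m.
  rewrite -ltnS; apply: leq_trans lt_m; rewrite ltnS proper_card // properC.
  by rewrite properE subsetUr subUset sub1set (negbTE uB).
have [C [UC sub st]] := IH _ ltU.
exists C; split=> //; last exact: subset_trans (subsetUr _ _) sub.
apply: connect_trans UC; apply: connect1.
by apply/existsP; exists v; apply/existsP; exists u; rewrite vu eqxx.
Qed.

Lemma forces_allW L L' B : L' \subset L -> forces_all L B -> forces_all L' B.
Proof.
move=> sL; apply: connect_sub => C D /existsP[v /existsP[u /andP[cf eqD]]].
apply: connect1; apply/existsP; exists v; apply/existsP; exists u.
rewrite eqD andbT; case/and5P: cf => vC vL vu uC all.
by rewrite /can_force vC vu uC all (contra (subsetP sL v)).
Qed.

Lemma leaky_forcing_number_le l B :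
  leaky_forcing_set l B -> leaky_forcing_number G l <= #|B|.
Proof.
rewrite /leaky_forcing_number; case: arg_minnP => [|A _ min]; last exact: min.
exact: leaky_forcing_setT.
Qed.

Lemma leaky_forcing_number_ge l k :
  (forall B, leaky_forcing_set l B -> k <= #|B|) ->
  k <= leaky_forcing_number G l.
Proof.
rewrite /leaky_forcing_number; case: arg_minnP => [|A lA _]; last exact.
exact: leaky_forcing_setT.
Qed.

(** The vertex [x] serves as a leak to be ignored: in the empty graph there is
    no set of one leak, so that the hypothesis would be vacuous. *)
Lemma leaky_forcing_set01 (x : G) B :
  leaky_forcing_set 1 B -> leaky_forcing_set 0 B.
Proof.
move=> /forallP/(_ [set x]); rewrite cards1 eqxx /= => fB.
apply/forallP=> L; apply/implyP; rewrite cards_eq0 => /eqP->.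
by apply: forces_allW fB; exact: sub0set.
Qed.

(** If some position of [1 .. m] is uncoloured, let [q i.+2] be the first such
    vertex and [q j] the last one, so that [i.+2 <= j]. The blue vertices
    [q i.+1] and [q j.+1] see a single uncoloured neighbour each, so in a stalled
    colouring both are the leak, although they occupy different positions in
    the period [1 .. m]. *)
Lemma closed_walk_blue (x : G) B C m (q : nat -> G) :
    0 < m -> stalled [set x] C -> B \subset C ->
    (forall k, adj (q k) (q k.+1)) ->
    (forall k, q (m + k) = q k) ->
    (forall i j, 0 < i <= m -> 0 < j <= m -> q i = q j -> i = j) ->
    (forall k w, adj (q k.+1) w -> [|| w \in B, w == q k | w == q k.+2]) ->
    q 0 \in B -> q 1 \in B ->
  forall k, q k \in C.
Proof.
move=> m_gt0 st sBC qadj per inj nb q0 q1.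
have leak v u : v \in C -> adj v u -> u \notin C ->
    (forall w, adj v w -> w \notin C -> w = u) -> v = x.
  move=> vC vu uC only; apply/eqP; rewrite -in_set1; apply/negPn/negP => vx.
  have /forallP/(_ v)/forallP/(_ u)/negP[] := st.
  rewrite /can_force vC vx vu uC; apply/forallP=> w; apply/implyP=> /andP[? ?].
  by apply/eqP; apply: only.
have fwd k : q k \in C -> q k.+1 \in C -> q k.+2 \notin C -> q k.+1 = x.
  move=> kC k1C k2C; apply: leak k2C _ => // w /nb/or3P[wB|/eqP->|/eqP->] //.
    by rewrite (subsetP sBC).
  by rewrite kC.
have bwd k : q k.+2 \in C -> q k.+1 \in C -> q k \notin C -> q k.+1 = x.
  move=> k2C k1C kC; apply: leak (kC) _ => //; first by rewrite adj_sym.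
  move=> w /nb/or3P[wB|/eqP->|/eqP->] //.
    by rewrite (subsetP sBC).
  by rewrite k2C.
have q0C := subsetP sBC _ q0; have q1C := subsetP sBC _ q1.
have inC k : k <= m -> q k \in C.
  move=> km; apply/negPn/negP => kC.
  have [i iC imin] := ex_minnP (ex_intro (fun i => q i \notin C) k kC).
  have Pk : (k <= m) && (q k \notin C) by rewrite km.
  have ubP j : (j <= m) && (q j \notin C) -> j <= m by case/andP.
  have [j /andP[jm jC] jmax] :=
    ex_maxnP (ex_intro (fun j => (j <= m) && (q j \notin C)) k Pk) ubP.
  have ik := imin _ kC; have kj := jmax _ Pk.
  case: i iC imin ik => [|[|i]] iC imin ik.
  - by rewrite q0C in iC.
  - by rewrite q1C in iC.
  have lt_i h : h < i.+2 -> q h \in C.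
    by move=> hi; apply/negPn/negP => /imin; rewrite leqNgt hi.
  have xi := fwd i (lt_i _ (leqnSn _)) (lt_i _ (leqnn _)) iC.
  have gt_j h : j < h <= m.+1 -> q h \in C.
    case/andP=> jh; rewrite leq_eqVlt ltnS => /orP[/eqP->|hm].
      by rewrite -addn1 per.
    by apply/negPn/negP => hC; have := jmax h; rewrite hm hC leqNgt jh => /(_ isT).
  have jm' : j < m.
    rewrite ltn_neqAle jm andbT; apply: contraNneq jC => ->.
    by rewrite -[m]addn0 per.
  have xj : q j.+1 = x by apply: bwd jC; apply: gt_j; lia.
  have : i.+1 = j.+1 by apply: inj; rewrite ?xi ?xj //; lia.
  lia.
move=> k; rewrite (divn_eq k m); elim: (k %/ m) => [|h IH].
  by rewrite inC // ltnW ?ltn_pmod.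
by rewrite mulSn -addnA per.
Qed.

(** * Nullity bound for zero forcing *)

Local Open Scope ring_scope.

Lemma exists_common_zero (F : fieldType) (T J : finType) (c : J -> T -> F) :
  (#|J| < #|T|)%N ->
  exists2 f : T -> F, (exists x, f x != 0) & forall j, \sum_x c j x * f x = 0.
Proof.
move=> ltJT.
pose A := \matrix_(i < #|T|, j < #|J|) c (enum_val j) (enum_val i).
have kerN0 : kermx A != 0.
  by rewrite -mxrank_eq0 mxrank_ker subn_eq0 -ltnNge (leq_ltn_trans (rank_leq_col A)).
pose v := nz_row (kermx A).
have vA : v *m A = 0 by apply/sub_kermxP; exact: nz_row_sub.
exists (fun x => v 0 (enum_rank x)).
  have /rV0Pn[i vi] : v != 0 by rewrite nz_row_eq0.
  by exists (enum_val i); rewrite enum_valK.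
move=> j; have /rowP/(_ (enum_rank j)) := vA; rewrite !mxE; apply: etrans.
rewrite (reindex_onto enum_val enum_rank) /=; last by move=> x _; exact: enum_rankK.
apply: eq_big => [i|i _]; first by rewrite enum_valK eqxx.
by rewrite !mxE enum_valK enum_rankK mulrC.
Qed.

(** When [v] forces [u], every term but that of [u] vanishes in row [v] of the
    system [w f = 0]; as [w v u] is invertible, [f u = 0]. *)
Lemma kernel_vanishing (F : fieldType) (w : G -> G -> F) (f : G -> F) L B :
    (forall v u, (w v u != 0) = adj v u) ->
    (forall v, \sum_u w v u * f u = 0) ->
    forces_all L B -> {in B, forall x, f x = 0} ->
  forall x, f x = 0.
Proof.
move=> wE ker /connectP[s]; elim: s B => [|C s IH] B /=.
  by move=> _ <- fB x; rewrite fB ?inE.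
case/andP=> /existsP[v /existsP[u /andP[/and5P[vB _ vu uB only] /eqP->]]] pth lst fB.
apply: IH pth lst _ => x; rewrite in_setU1 => /orP[/eqP->{x}|]; last exact: fB.
have := ker v; rewrite (bigD1 u) //= big1 ?addr0.
  by move/eqP; rewrite mulf_eq0 (negbTE (_ : w v u != 0)) ?wE // => /eqP.
move=> y yu; have [yB|yB] := boolP (y \in B); first by rewrite fB ?mulr0.
have [vy|vy] := boolP (adj v y).
  by move/forallP/(_ y): only; rewrite vy yB (negbTE yu).
by move: vy; rewrite -wE negbK => /eqP->; rewrite mul0r.
Qed.

(** The equations [c] cut out a subspace of the kernel of [w] of codimension at
    most [#|J|]. If [B] were smaller than the dimension of this subspace, then
    some nonzero vector in it would vanish on [B], against
    [kernel_vanishing]. *)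
Lemma zero_forcing_ge_nullity (F : fieldType) (w : G -> G -> F)
    (J : finType) (c : J -> G -> F) L B :
    (forall v u, (w v u != 0) = adj v u) ->
    (forall f : G -> F, (forall j, \sum_u c j u * f u = 0) ->
       forall v, \sum_u w v u * f u = 0) ->
    forces_all L B ->
  (#|G| <= #|B| + #|J|)%N.
Proof.
move=> wE cker fB; rewrite leqNgt; apply/negP=> lt.
pose d (j : {x | x \in B} + J) (u : G) : F :=
  match j with inl b => (u == val b)%:R | inr j => c j u end.
have [|f [x fx] df] := @exists_common_zero F G _ d.
  by rewrite card_sum card_sig.
case/eqP: fx; apply: kernel_vanishing wE _ fB _ x.
  by apply: cker => j; exact: (df (inr j)).
move=> b bB; have := df (inl (exist _ b bB)); rewrite (bigD1 b) //= eqxx mul1r.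
by rewrite big1 ?addr0 // => u /negbTE->; rewrite mul0r.
Qed.

End Forcing.

(** * The cycle and its shift *)

(** The number of connected components of [K_2 x C_t]. *)
Definition num_cycles t := if odd t then 1 else 2.

(** The two neighbours of [i] in [C_t] differ by [2] modulo [t]; for even [t]
    this keeps the parity, even across the wrap-around. *)
Lemma ordS_ord_pred_mod t (i : 'I_t) :
  ordS i = ord_pred i %[mod num_cycles t].
Proof.
rewrite /num_cycles /=; have := ltn_ord i; case: ifP => [_|tE] it.
  by rewrite !modn1.
have d2t : 2 %| t by rewrite dvdn2 tE.
rewrite !modn_dvdm //; lia.
Qed.

Lemma ordS_neq_ord_pred t (i : 'I_t) : 2 < t -> ordS i != ord_pred i.
Proof.
case: i => k kt t3; apply/eqP => /(congr1 val) /=.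
have [->|k0] := posnP k; first by rewrite add0n !modn_small; lia.
have -> : (k + t).-1 = k.-1 + t by lia.
rewrite modnDr [k.-1 %% _]modn_small; last lia.
have [lt|ge] := ltnP k.+1 t; first by rewrite modn_small //; lia.
have -> : k.+1 = t by lia.
rewrite modnn; lia.
Qed.

Lemma eq_ordS_sym t (i j : 'I_t) : (i == ordS j) = (j == ord_pred i).
Proof. by apply/eqP/eqP=> ->; rewrite ?ordSK ?ord_predK. Qed.

Lemma ordS_neq t (i : 'I_t) : 2 < t -> (i == ordS i) = false.
Proof.
move=> t3; apply/negP=> /eqP e; have e' : ord_pred i = i by rewrite {1}e ordSK.
by have := ordS_neq_ord_pred i t3; rewrite e' -e eqxx.
Qed.

(** * Lower bound: a weighted adjacency matrix of large nullity *)

Section LowerBound.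
Local Open Scope ring_scope.
Variables n t : nat.
Hypothesis t_ge3 : (2 < t)%N.
Let G := direct_prod (complete_graph n) (cycle_graph t).
Let d := num_cycles t.

(** The tensor product of [(a - b)_(a, b)] and of shift minus inverse shift. *)
Definition weight (v u : G) : rat :=
  ((v.1 : nat)%:R - (u.1 : nat)%:R)
    * ((u.2 == ordS v.2)%:R - (u.2 == ord_pred v.2)%:R).

Lemma weight_neq0 v u : (weight v u != 0) = adj v u.
Proof.
case: v u => [a i] [b j]; rewrite /weight /= /direct_prod_rel /=.
rewrite /complete_rel /cycle_rel.
rewrite mulf_eq0 negb_or subr_eq0 eqr_nat; congr (_ && _).
rewrite (eq_ordS_sym i j); have [->|ij] := eqVneq i j.
  by rewrite ordS_neq // -eq_ordS_sym ordS_neq // subrr eqxx.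
rewrite andTb; have [->|_] := eqVneq j (ordS i).
  by rewrite (negbTE (ordS_neq_ord_pred i t_ge3)) subr0 oner_eq0.
by rewrite sub0r oppr_eq0; case: (j == _).
Qed.

Definition row_power (b : bool) (u : G) : rat := if b then (u.1 : nat)%:R else 1.

Definition moment b (f : G -> rat) k : rat :=
  \sum_u row_power b u * (u.2 == k :> nat)%:R * f u.

(** The equation saying that a moment takes the same value on the columns [k]
    and [k + d]; the range [k < t - d] avoids the wrap-around. *)
Definition constraint (j : bool * 'I_(t - d)) (u : G) : rat :=
  row_power j.1 u * ((u.2 == j.2 + d :> nat)%N%:R - (u.2 == j.2 :> nat)%:R).

Lemma moment_modn b f k :
    (forall j, \sum_u constraint j u * f u = 0) -> (k < t)%N ->
  moment b f k = moment b f (k %% d)%N.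
Proof.
move=> cf; elim/ltn_ind: k => k IH kt.
have [kd|dk] := ltnP k d; first by rewrite modn_small.
have d0 : (0 < d)%N by rewrite /d /num_cycles; case: odd.
have kdt : (k - d < t - d)%N by lia.
have -> : (k %% d = (k - d) %% d)%N by rewrite -{1}(subnK dk) modnDr.
rewrite -IH; [|lia|lia].
apply/eqP; rewrite -subr_eq0; apply/eqP.
rewrite -[RHS](cf (b, Ordinal kdt)) -sumrB; apply: eq_bigr => u _.
by rewrite /constraint /= subnK // -mulrBl -mulrBr.
Qed.

(** Since [a - b] separates the row variables, row [(a, i)] of [weight] applied
    to [f] is a combination of the differences of the two moments of [f] between
    the columns [i + 1] and [i - 1], which are congruent modulo [d]. *)
Lemma constraint_kernel f :
  (forall j, \sum_u constraint j u * f u = 0) ->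
  forall v, \sum_u weight v u * f u = 0.
Proof.
move=> cf v.
have mE b : moment b f (ordS v.2) - moment b f (ord_pred v.2) = 0.
  rewrite (moment_modn _ cf) // (moment_modn b cf (ltn_ord (ord_pred _))).
  by rewrite ordS_ord_pred_mod subrr.
transitivity ((v.1 : nat)%:R
     * (moment false f (ordS v.2) - moment false f (ord_pred v.2))
   - (moment true f (ordS v.2) - moment true f (ord_pred v.2))); last first.
  by rewrite !mE mulr0 subrr.
rewrite /moment -!sumrB mulr_sumr -sumrB; apply: eq_bigr => u _.
by rewrite /weight /row_power -!val_eqE /=; ring.
Qed.

Lemma zero_forcing_lower_bound (B : {set G}) :
  (2 <= n)%N -> leaky_forcing_set 0 B -> ((n - 2) * t + 2 * d <= #|B|)%N.
Proof.
move=> n2 /forallP/(_ set0); rewrite cards0 eqxx /= => fB.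
have := zero_forcing_ge_nullity weight_neq0 constraint_kernel fB.
rewrite !card_prod !card_ord card_bool => le.
have dt : (d <= t)%N by rewrite /d /num_cycles; case: odd; lia.
have nE : (n * t = (n - 2) * t + 2 * t)%N by rewrite -mulnDl subnK.
by move: d dt le => d1; rewrite nE; move: ((n - 2) * t)%N #|B| => m b; lia.
Qed.

End LowerBound.

(** * Upper bound: forcing around the cycles of rows 0 and 1 *)

Section UpperBound.
Variables n' t : nat.
Hypothesis t_ge3 : 2 < t.
Let n := n'.+2.
Let G := direct_prod (complete_graph n) (cycle_graph t).
Let d := num_cycles t.

Let t_gt0 : 0 < t. Proof. exact: ltn_trans t_ge3. Qed.

Definition column k : 'I_t := Ordinal (ltn_pmod k t_gt0).

Lemma columnS k : column k.+1 = ordS (column k).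
Proof. by apply: val_inj; rewrite /= -addn1 -modnDml addn1. Qed.

Lemma column_ord (i : 'I_t) : column i = i.
Proof. by apply: val_inj; rewrite /= modn_small. Qed.

(** Starts in row [s] of column [0], then alternates between rows [0] and [1]
    while advancing one column at each step. *)
Definition walk (s k : nat) : G := (inord (odd (s + k)), column k).

(** For odd [t], the walk comes back to column [0] in the other row, and closes
    up only after a second turn. *)
Definition walk_period := if odd t then 2 * t else t.

Lemma walk_row s k : (walk s k).1 = odd (s + k) :> nat.
Proof. by rewrite /= inordK // /n; case: odd. Qed.

Lemma walk_eq s k (u : G) :
  (u == walk s k) = (u.1 == odd (s + k) :> nat) && (u.2 == column k).
Proof. by case: u => a i; rewrite -walk_row. Qed.

Lemma walk_adj s k : adj (walk s k) (walk s k.+1).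
Proof.
apply/andP; split; last first.
  by rewrite /= /cycle_rel columnS ordS_neq // eqxx.
apply/eqP=> /(congr1 val); rewrite [LHS](walk_row s k) [RHS](walk_row s k.+1).
by rewrite addnS /=; case: odd.
Qed.

Lemma walk_periodic s k : walk s (walk_period + k) = walk s k.
Proof.
apply/eqP; rewrite walk_eq walk_row -val_eqE /= /walk_period; case: ifP => tE.
  by rewrite modnMDl oddD (oddD (2 * t)) oddM oddD !eqxx.
by rewrite modnDl !oddD tE !eqxx.
Qed.

(** Positions in the same column differ by a multiple of [t]. Within a period
    the only nonzero possibility is [t] itself, for odd [t], and then the rows
    differ. *)
Lemma walk_inj s i j : 0 < i <= walk_period -> 0 < j <= walk_period ->
  walk s i = walk s j -> i = j.
Proof.
wlog ij : i j / i <= j => [wl|].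
  have [/wl//|/ltnW ji iP jP /esym/wl->//] := leqP i j.
rewrite /walk_period => iP jP /eqP; rewrite walk_eq walk_row -val_eqE /=.
rewrite !oddD => /andP[/eqP par].
rewrite eq_sym eqn_mod_dvd // => /dvdnP[q qE].
case: ifP iP jP => tE iP jP; last first.
  have q0 : q < 1 by rewrite -(ltn_pmul2r t_gt0) -qE; lia.
  by move: q0 qE; rewrite ltnS leqn0 => /eqP->; lia.
have q2 : q < 2 by rewrite -(ltn_pmul2r t_gt0) -qE; lia.
case: q q2 qE => [|[|//]] _ qE; first by lia.
have jE : j = i + t by lia.
by move: par; rewrite jE oddD tE; case: odd; case: odd.
Qed.

Definition blue : {set G} :=
  [set u : G | 1 < u.1] :|: [set walk (val p.1) (val p.2) | p : 'I_d * 'I_2].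

Lemma card_blue : #|blue| <= (n - 2) * t + 2 * d.
Proof.
apply: leq_trans (leq_card_setU _ _) _; apply: leq_add; last first.
  by apply: leq_trans (leq_imset_card _ _) _; rewrite card_prod !card_ord mulnC.
pose f (p : 'I_n' * 'I_t) : G := (lift ord0 (lift ord0 p.1), p.2).
apply: leq_trans (_ : #|f @: setT| <= _).
  apply: subset_leq_card; apply/subsetP=> -[[a an] i]; rewrite inE /= => a1.
  have a2 : a - 2 < n' by move: an; rewrite /n; lia.
  apply/imsetP; exists (Ordinal a2, i); rewrite ?inE //.
  by congr pair; apply: val_inj; rewrite /= /bump; lia.
apply: leq_trans (leq_imset_card _ _) _.
by rewrite cardsT card_prod !card_ord /n !subSS subn0.
Qed.

(** A neighbour of [walk s k.+1] in rows [0] and [1] must lie in the opposite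
    row, so that its column, next or previous, determines it. *)
Lemma walk_nbr s k w :
  adj (walk s k.+1) w -> [|| w \in blue, w == walk s k | w == walk s k.+2].
Proof.
case: w => b j; rewrite !walk_eq !addnS /= negbK => /andP[/= ab].
rewrite /cycle_rel /= => /andP[_ step].
have [b1|b1] := ltnP 1 b; first by rewrite !inE b1.
have odd_b : odd (s + k.+1) != b :> nat.
  apply: contra ab => /eqP e; apply/eqP/val_inj.
  by rewrite [LHS](walk_row s k.+1).
have -> : b = odd (s + k) :> nat.
  by move: odd_b b1; rewrite addnS /=; case: odd; case: (val b) => [|[]].
rewrite eqxx /=; case/orP: step => [/eqP->|].
  by rewrite -columnS eqxx !orbT.
by rewrite columnS (inj_eq (@ordS_inj _)) eq_sym => ->; rewrite orbT.
Qed.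

(** For even [t], the parity of [a + i] is constant along a walk and selects it.
    For odd [t], the first turn of the single walk meets the vertices whose row
    and column have the same parity, and the second turn meets the others. *)
Lemma walk_cover (u : G) : u.1 <= 1 -> exists s k, s < d /\ u = walk s k.
Proof.
case: u => a i /= a1; rewrite /d /num_cycles.
have aE : odd a = a :> nat by case: (val a) a1 => [|[]].
case: ifP => tE; last first.
  exists (odd (a + i)), i; split; first by case: odd.
  apply/eqP; rewrite walk_eq /= column_ord eqxx andbT -aE !oddD.
  by case: (odd a); case: (odd i).
exists 0, (if odd a == odd i then i : nat else t + i); split=> //.
apply/eqP; rewrite walk_eq; apply/andP; split; last first.
  by apply/eqP/val_inj; case: ifP => _ /=; rewrite ?modnDl modn_small.
rewrite add0n -[X in X == _]aE; case: ifP => [/eqP->//|].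
by rewrite oddD tE; case: (odd a); case: (odd i).
Qed.

Lemma blue_leaky : leaky_forcing_set 1 blue.
Proof.
apply/forallP=> L; apply/implyP=> /cards1P[x ->].
have [C [BC sub st]] := connect_stalled [set x] blue.
suff CT : C = [set: G] by rewrite /forces_all -CT.
apply/setP=> u; rewrite inE; have [u1|/walk_cover[s [k [sd ->]]]] := ltnP 1 u.1.
  by rewrite (subsetP sub) // !inE u1.
have wB h : h < 2 -> walk s h \in blue.
  move=> h2; rewrite inE; apply/orP; right.
  by apply/imsetP; exists (Ordinal sd, Ordinal h2).
apply: (closed_walk_blue _ st sub (walk_adj s) (walk_periodic s)).
- by rewrite /walk_period; case: odd; lia.
- exact: walk_inj.
- exact: walk_nbr.
- exact: wB.
- exact: wB.
Qed.

End UpperBound.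

Theorem theorem2p3 (n t : nat) (hn : 2 <= n) (ht : 3 <= t) :
  let G := direct_prod (complete_graph n) (cycle_graph t) in
  resilient G 1 /\
  leaky_forcing_number G 1 = leaky_forcing_number G 0 /\
  leaky_forcing_number G 0 =
    (if odd t then (n - 2) * t + 2 else (n - 2) * t + 4).
Proof.
case: n hn => [|[|n]] // hn G.
set N := if odd t then _ else _.
have NE : N = (n.+2 - 2) * t + 2 * num_cycles t.
  by rewrite /N /num_cycles; case: odd.
have ub : leaky_forcing_number G 1 <= N.
  rewrite NE; apply: leq_trans (card_blue n ht).
  exact: leaky_forcing_number_le (blue_leaky n ht).
have lb : N <= leaky_forcing_number G 0.
  by rewrite NE; apply: leaky_forcing_number_ge => B; apply: zero_forcing_lower_bound.
have le01 : leaky_forcing_number G 0 <= leaky_forcing_number G 1.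
  apply: leaky_forcing_number_ge => B fB; apply: leaky_forcing_number_le.
  exact: (@leaky_forcing_set01 G (walk n ht 0 0) B fB).
by rewrite /resilient; split; [|split]; apply/eqP; rewrite eqn_leq; lia.
Qed.
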